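(* Let $n \ge 1$, $b \ge 0$, and $0 < \varepsilon \le 1/2$. Consider the single-processor cup game on $n$ cups with parameter $\varepsilon$ beginning from a starting state in which $b$ units of water have been dispersed arbitrarily among the cups, and suppose the emptier uses the smoothed greedy algorithm against an oblivious filler. There exist absolute constants $C, c > 0$ such that for every oblivious filler, every initial distribution of the $b$ units, every step $i > b/\varepsilon$, and every real $k \ge 0$ with $3\log\frac{1}{\varepsilon} \le k$, the probability that the backlog after step $i$ is $k$ or greater is at most $C \cdot 2^{-2^{ck}}$.
   Context: Single-processor cup game with parameter $\varepsilon$: $n$ cups; in each step the filler pours nonnegative amounts $c_j(i)$ with $\sum_j c_j(i) \le 1-\varepsilon$, then the emptier may remove up to one unit of water from one cup. The filler is oblivious (amounts fixed in advance, independent of the emptier's randomness). Smoothed greedy algorithm: at the start the emptier draws independent uniform $r_1,\dots,r_n \in (0,1]$ and adds $r_j$ units to cup $j$; at the end of each step, if every cup contains less than one unit the emptier does nothing, otherwise it removes exactly one unit from a fullest cup. The backlog after a step is the maximum fill of any cup (fills include the inserted $r_j$ and the initial water). *)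

(* Defs.v *)
From HB Require Import structures.
From mathcomp Require Import all_boot all_order all_algebra.
From mathcomp Require Import all_classical all_reals all_analysis.
Set Implicit Arguments.
Unset Strict Implicit.
Unset Printing Implicit Defensive.
Import Order.TTheory GRing.Theory Num.Theory.
Import numFieldNormedType.Exports.
Local Open Scope classical_set_scope.
Local Open Scope ring_scope.

Definition log2 (R : realType) (x : R) : R := ln x / ln 2.

(* Steps are numbered from 1: step i pours c i j into cup j, and c 0 is unused.
   Obliviousness is in the type: c does not depend on any random outcome. *)
Definition oblivious_filler (R : realType) (n : nat) (eps : R)
    (c : nat -> 'I_n -> R) : Prop :=
  forall i, (0 < i)%N ->
    (forall j, 0 <= c i j) /\ \sum_(j < n) c i j <= 1 - eps.

Definition initial_state (R : realType) (n : nat) (b : R)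
    (s : 'I_n -> R) : Prop :=
  (forall j, 0 <= s j) /\ \sum_(j < n) s j = b.

(* A relation rather than a function, because the algorithm does not say which
   fullest cup is chosen in case of a tie. *)
Definition greedy_removal (R : realType) (n : nat) (x y : 'I_n -> R) : Prop :=
  ((forall j, x j < 1) /\ (forall l, y l = x l)) \/
  ((exists j, 1 <= x j) /\
   exists j, (forall l, x l <= x j) /\
             (forall l, y l = if l == j then x l - 1 else x l)).

(* The default value 0 of the maximum is harmless: fills are nonnegative. *)
Definition backlog (R : realType) (n : nat) (x : 'I_n -> R) : R :=
  \big[Num.max/0]_(j < n) x j.

Section randomness.
Context (d : measure_display) (T : measurableType d) (R : realType).
Variables (P : probability T R) (n : nat).

Definition mutually_independent (X : 'I_n -> {RV P >-> R}) : Prop :=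
  forall (J : {set 'I_n}) (A : 'I_n -> set R),
    (forall j, measurable (A j)) ->
    P [set w | forall j, j \in J -> A j (X j w)] =
    (\prod_(j in J) P (X j @^-1` A j))%E.

(* uniform_prob is defined through `[0, 1]; it gives {0} mass 0. *)
Definition uniform_oc01 (X : {RV P >-> R}) : Prop :=
  (forall w, 0 < X w <= 1) /\
  (forall A : set R, measurable A ->
     distribution P X A = uniform_prob (@ltr01 R) A).

(* F i j is the fill of cup j after step i (F 0 j: after the insertion of r j),
   when the initial water is s and the filler plays c. *)
Definition smoothed_greedy (s : 'I_n -> R) (c : nat -> 'I_n -> R)
    (r : 'I_n -> {RV P >-> R}) (F : nat -> 'I_n -> {RV P >-> R}) : Prop :=
  [/\ mutually_independent r,
      forall j, uniform_oc01 (r j),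
      forall j w, F 0 j w = s j + r j w &
      forall i w, greedy_removal (fun j => F i j w + c i.+1 j)
                                 (fun j => F i.+1 j w)].

End randomness.

(* Main.v *)
(* Call a step calm if afterwards every cup holds less than 2 units. A step
   up to i is calm: otherwise each of the first i steps removes a unit from a cup
   that keeps at least 1 unit forever after, so that cup j loses at most
   s j + r j - 1 plus what was poured into it, and i <= b + (1 - eps) i < i.

   Let i - l be the last calm step up to i. If l <= 2^p, the classical greedy
   argument on the average fill of the fullest m cups, started from the calm step,
   gives backlog at most 3 + p < k. If l > 2^p, each of the last l steps removes
   a unit, and cup j, which receives C_j units in this period, loses at most
   floor(C_j) + 1 of them, the last one only if r j lies in a set of measure
   C_j - floor(C_j). These events are independent over j, so Chernoff's bound makes the
   case of a given l have probability at most exp(- l eps^2 / 4). Summing over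
   l > 2^p, where 2^p is about 2^k >= 2^(k/3) / eps^2, gives the bound. *)

Require Import Defs.
From HB Require Import structures.
From mathcomp Require Import all_boot all_order all_algebra.
From mathcomp Require Import all_classical all_reals all_analysis.
From mathcomp Require Import measurable_realfun ring lra zify.
Set Implicit Arguments.
Unset Strict Implicit.
Unset Printing Implicit Defensive.
Import Order.TTheory GRing.Theory Num.Theory.
Import numFieldNormedType.Exports.
Local Open Scope classical_set_scope.
Local Open Scope ring_scope.

(** * Deterministic greedy trajectories *)

Section trajectory.
Variables (R : realType) (n : nat) (c : nat -> 'I_n -> R) (x : nat -> 'I_n -> R).
Hypothesis c_ge0 : forall t j, 0 <= c t.+1 j.
Hypothesis greedy : forall t, greedy_removal (fun j => x t j + c t.+1 j) (x t.+1).

Definition poured (t l : nat) (j : 'I_n) : R := \sum_(m < l) c (t + m).+1 j.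

Lemma poured_ge0 t l j : 0 <= poured t l j.
Proof. exact: sumr_ge0. Qed.

(** Only the integrality of [q] matters: the fill modulo 1 is determined by the initial fill of the
    cup and the filler. *)
Lemma removed_count t j : exists q : nat, x t j = x 0 j + poured 0 t j - q%:R.
Proof.
elim: t => [|t [q IH]]; first by exists 0%N; rewrite /poured big_ord0 addr0 subr0.
rewrite /poured big_ord_recr/= -/(poured 0 t j) add0n.
case: (greedy t) => [[_ ->]|[_ [j0 [_ ->]]]].
  by exists q; rewrite IH; lra.
case: ifP => _; last by exists q; rewrite IH; lra.
by exists q.+1; rewrite IH -natr1; lra.
Qed.

(** A step that ends with a cup of at least 2 units takes its unit from a cup holding at least 2.
    That cup keeps at least 1, and neither pouring nor later removals in the period bring it below
    1. *)
Lemma busy_removals t l :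
    (forall m, (t < m <= t + l)%N -> exists j, 2 <= x m j) ->
  exists rem : 'I_n -> nat, [/\ (\sum_j rem j)%N = l,
    forall j, x (t + l) j = x t j + poured t l j - (rem j)%:R &
    forall j, (0 < rem j)%N -> 1 <= x (t + l) j].
Proof.
elim: l => [|l IH] busy.
  exists (fun=> 0%N); split => //; first by rewrite big1.
  by move=> j; rewrite addn0 /poured big_ord0 addr0 subr0.
have [|rem [sum_rem x_rem rem_ge1]] := IH.
  by move=> m /andP[tm ml]; apply: busy; rewrite tm (leq_trans ml)// leq_add2l.
have [j2 xj2] := busy (t + l).+1 ltac:(lia).
have [[lt1 eqx]|[_ [j0 [max0 eqx]]]] := greedy (t + l).
  by have := eqx j2; have := lt1 j2 => /=; lra.
have pre2 : 2 <= x (t + l) j0 + c (t + l).+1 j0.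
  by apply: le_trans (max0 j2) => /=; move: xj2; rewrite eqx /=; case: ifP => _; lra.
exists (fun j => rem j + (j == j0))%N; split.
- rewrite big_split/= sum_rem (bigD1 j0)//= eqxx big1 ?addn0 ?addn1//.
  by move=> j /negbTE ->.
- move=> j; rewrite addnS eqx x_rem /poured big_ord_recr/=.
  by case: eqP => _; rewrite natrD /= ?mulr1n ?mulr0n; lra.
- move=> j; rewrite addnS eqx; case: eqP => [->|_]; first by lra.
  by rewrite addn0 => /rem_ge1; have := c_ge0 (t + l) j; lra.
Qed.

Hypothesis c_le1 : forall t, \sum_j c t.+1 j <= 1.

Definition harmonic_tail (W m : nat) : R := \sum_(m.+1 <= i < W.+1) i%:R^-1.

(* Removing from a cup outside [U] is compared with the set [U] enlarged by that
   cup, whence the harmonic increments. *)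
Lemma greedy_balance t W l : (forall j, x t j < 2) -> (l <= W)%N ->
  forall U : {set 'I_n},
    \sum_(j in U) x (t + l) j <= #|U|%:R * (3 + harmonic_tail W #|U|).
Proof.
move=> lt2 lW.
(* This settles large sets: if [l <= W <= #|U|], the summand [l] adds at most 1 per cup, whence the
   3 in place of 2. *)
have crude : forall l' (U : {set 'I_n}),
    \sum_(j in U) x (t + l') j <= 2 * #|U|%:R + l'%:R.
  elim => [|l' IH] U.
    rewrite addn0 addr0 mulr_natr -sumr_const.
    by apply: ler_sum => j _; exact: ltW.
  apply: (@le_trans _ _ (\sum_(j in U) (x (t + l') j + c (t + l').+1 j))).
    apply: ler_sum => j _; rewrite addnS.
    case: (greedy (t + l')) => [[_ ->]//|[_ [j0 [_ ->]]]].
    by case: ifP => _; lra.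
  have -> : l'.+1%:R = l'%:R + 1 :> R by rewrite natr1.
  rewrite big_split/= addrA lerD//.
  apply: le_trans (c_le1 (t + l')).
  by rewrite [leRHS](bigID (mem U))/= lerDl sumr_ge0.
have tail_ge0 m : 0 <= harmonic_tail W m.
  by apply: sumr_ge0 => i _; rewrite invr_ge0.
elim: l lW => [_|l IH lW] U.
  rewrite (le_trans (crude 0%N U))// addr0 mulrC ler_wpM2l//.
  by have := tail_ge0 #|U|; lra.
have [WU|UW] := leqP W #|U|.
  apply: (le_trans (crude l.+1 U)).
  have : (l.+1%:R <= #|U|%:R :> R) by rewrite ler_nat (leq_trans lW).
  have := mulr_ge0 (ler0n R #|U|) (tail_ge0 #|U|); lra.
have {}IH := IH (ltnW lW).
have tailS : harmonic_tail W #|U| = #|U|.+1%:R^-1 + harmonic_tail W #|U|.+1.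
  by rewrite /harmonic_tail big_ltn.
rewrite addnS.
have [[lt1 eqx]|[_ [j0 [max0 eqx]]]] := greedy (t + l).
  rewrite mulr_natl -sumr_const ler_sum// => j _; rewrite eqx.
  by have := lt1 j; have := tail_ge0 #|U|; lra.
have c_sub (V : {set 'I_n}) : \sum_(j in V) c (t + l).+1 j <= 1.
  apply: le_trans (c_le1 (t + l)).
  by rewrite [leRHS](bigID (mem V))/= lerDl sumr_ge0.
(* If [j0] is in [U], the removed unit offsets the water poured into [U]. Otherwise the average over
   [U] is at most the average over the enlarged set before the removal, which has risen by at most
   [1 / (#|U| + 1)]. *)
have [j0U|j0U] := boolP (j0 \in U).
  apply: le_trans (IH U).
  rewrite (bigD1 j0)//= eqx eqxx [leRHS](bigD1 j0)//=.
  have := c_sub U; rewrite (bigD1 j0)//=.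
  have -> : \sum_(j in U | j != j0) x (t + l).+1 j =
      \sum_(j in U | j != j0) x (t + l) j + \sum_(j in U | j != j0) c (t + l).+1 j.
    by rewrite -big_split/=; apply: eq_bigr => j /andP[_ /negbTE jj]; rewrite eqx jj.
  lra.
have eqU : \sum_(j in U) x (t + l).+1 j = \sum_(j in U) (x (t + l) j + c (t + l).+1 j).
  apply: eq_bigr => j jU; rewrite eqx; case: eqP => // jj.
  by rewrite -jj jU in j0U.
have maxU : \sum_(j in U) (x (t + l) j + c (t + l).+1 j)
    <= #|U|%:R * (x (t + l) j0 + c (t + l).+1 j0).
  by rewrite mulr_natl -sumr_const; apply: ler_sum => j _; exact: max0.
have := IH (j0 |: U); rewrite cardsU1 j0U add1n big_setU1//=.
have := c_sub (j0 |: U); rewrite big_setU1//=.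
move: maxU; rewrite -eqU.
have -> : \sum_(j in U) x (t + l).+1 j =
    \sum_(j in U) x (t + l) j + \sum_(j in U) c (t + l).+1 j by rewrite eqU big_split.
set sx := \sum_(j in U) x _ j; set sc := \sum_(j in U) c _ j.
set p := x _ j0; set q := c _ j0.
rewrite tailS; set m := #|U|; set h := harmonic_tail W m.+1.
have m1 : 0 < m.+1%:R :> R by rewrite ltr0n.
have mm : m.+1%:R = m%:R + 1 :> R by rewrite -natr1.
move=> h1 h2 h3.
rewrite -(ler_pM2l m1).
have -> : m.+1%:R * (m%:R * (3 + (m.+1%:R^-1 + h))) = m%:R * (m.+1%:R * (3 + h) + 1) :> R.
  by field; rewrite gt_eqF.
have h4 : m%:R * (p + q + (sx + sc)) <= m%:R * (m.+1%:R * (3 + h) + 1).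
  by apply: ler_wpM2l => //; lra.
apply: le_trans h4; rewrite mm; lra.
Qed.

Lemma harmonic_pow2 p : harmonic_tail (2 ^ p) 1 <= p%:R.
Proof.
elim: p => [|p IH]; first by rewrite /harmonic_tail expn0 big_geq.
have p2 : (0 < 2 ^ p)%N by rewrite expn_gt0.
rewrite /harmonic_tail (@big_cat_nat _ _ _ (2 ^ p).+1)/=; last 2 first.
- by rewrite ltnS.
- by rewrite ltnS leq_exp2l.
rewrite -natr1 lerD//.
(* The new dyadic block has [2 ^ p] terms, each at most [1 / 2 ^ p]. *)
apply: (@le_trans _ _ (\sum_((2 ^ p).+1 <= i < (2 ^ p.+1).+1) (2 ^ p)%:R^-1)).
  apply: ler_sum_nat => i /andP[pi _].
  by rewrite lef_pV2 ?posrE ?ltr0n ?(leq_trans _ pi)// ler_nat ltnW.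
rewrite sumr_const_nat subSS expnS mul2n -addnn addnK.
by rewrite -[leLHS]mulr_natr mulVf// pnatr_eq0 -lt0n.
Qed.

Lemma greedy_fill_le t l p j : (forall j', x t j' < 2) -> (l <= 2 ^ p)%N ->
  x (t + l) j <= 3 + p%:R.
Proof.
move=> lt2 lp; have := greedy_balance lt2 lp [set j].
rewrite big_set1 cards1 mul1r => /le_trans; apply.
by rewrite lerD2l harmonic_pow2.
Qed.

End trajectory.

(** * Carries of fractional parts *)

Section carries.
Variable R : realType.

Definition frac_part (a : R) : R := a - (Num.truncn a)%:R.

Lemma frac_part_itv a : 0 <= a -> 0 <= frac_part a < 1.
Proof.
move=> /truncn_itv /andP[h1 h2]; rewrite /frac_part subr_ge0 h1/= ltrBlDl.
by rewrite -natr1 in h2.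
Qed.

(** Apart from one endpoint, these are the [r] in [0, 1] for which [a + r] has fractional part at
    least [1 - frac_part C]. Earlier removals do not enter, so against an oblivious filler the set
    is deterministic. *)
Definition carry_set (a C : R) : set R :=
  `[Num.max 0 (1 - frac_part C - frac_part a), 1 - frac_part a] `|`
  `[2 - frac_part C - frac_part a, 1].

Lemma measurable_carry_set a C : measurable (carry_set a C).
Proof. by apply: measurableU; exact: measurable_itv. Qed.

(* [r + a - q] is the fill of a cup at the start of a busy period in which it
   receives [C] and loses [rem] units. *)
Lemma removals_le_carry (r a C : R) (q rem : nat) : 0 < r <= 1 -> 0 <= a -> 0 <= C ->
    r + a - q%:R < 2 -> 1 <= r + a - q%:R + C - rem%:R ->
  (rem <= Num.truncn C + (r \in carry_set a C))%N.
Proof.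
move=> /andP[r0 r1] a0 C0 lt2 ge1.
have /andP[f0 f1] := frac_part_itv C0.
have /andP[al0 al1] := frac_part_itv a0.
have Ea : a = frac_part a + (Num.truncn a)%:R by rewrite /frac_part subrK.
have EC : C = frac_part C + (Num.truncn C)%:R by rewrite /frac_part subrK.
have [//|rem_gt] := leqP rem (Num.truncn C + (r \in carry_set a C)).
(* With [r] in the set, an excess would mean at least [floor C + 2] removals, too many for a cup
   that starts below 2 and ends with at least 1. *)
suff Dr : r \in carry_set a C.
  have : (Num.truncn C)%:R + 1 + 1 <= rem%:R :> R.
    by rewrite !natr1 ler_nat; rewrite Dr addn1 in rem_gt.
  lra.
have remS : (Num.truncn C)%:R + 1 <= rem%:R :> R.
  by rewrite natr1 ler_nat (leq_ltn_trans (leq_addr _ _) rem_gt).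
rewrite inE; rewrite /carry_set /=.
(* A starting fill below 2 leaves [q = floor a - 1], which gives the first interval, or
   [q >= floor a], which gives the second. *)
have [qA|Aq] := ltnP q (Num.truncn a).
  left; rewrite in_itv/= ge_max (ltW r0)/=.
  have qA' : q%:R + 1 <= (Num.truncn a)%:R :> R by rewrite natr1 ler_nat.
  have [Aq'|qA2] := leqP (Num.truncn a) q.+1.
    have Aq'' : (Num.truncn a)%:R <= q%:R + 1 :> R by rewrite natr1 ler_nat.
    by apply/andP; split; lra.
  suff : q%:R + 1 + 1 <= (Num.truncn a)%:R :> R by lra.
  by rewrite !natr1 ler_nat.
right; rewrite in_itv/= r1 andbT.
have Aq' : (Num.truncn a)%:R <= q%:R :> R by rewrite ler_nat.
lra.
Qed.

(** The density is at most 1, so interval lengths suffice. If the two fractional parts sum to less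
    than 1, the second interval is empty and the first has length at most [frac_part C]; otherwise
    the first starts at 0 and the lengths add up to [frac_part C]. *)
Lemma carry_set_prob (a C : R) : 0 <= a -> 0 <= C ->
  (uniform_prob (@ltr01 R) (carry_set a C) <= (frac_part C)%:E)%E.
Proof.
move=> a0 C0.
have /andP[f0 f1] := frac_part_itv C0.
have /andP[al0 al1] := frac_part_itv a0.
have mD := measurable_carry_set a C.
apply: (@le_trans _ _ (lebesgue_measure (carry_set a C))).
  rewrite -[leRHS]mul1e -integral_cst// /uniform_prob; apply: ge0_le_integral => //.
  - by move=> x _; rewrite lee_fin uniform_pdf_ge0.
  - apply/measurable_EFinP.
    exact: (measurable_funS measurableT (@subsetT _ _) (measurable_uniform_pdf 0 1)).
  - move=> x _; rewrite lee_fin /uniform_pdf subr0 invr1.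
    by case: ifP => _ //; exact: ler01.
apply: le_trans (measureU2 _ _ _) _; [exact: measurable_itv..|].
rewrite /= !lebesgue_measure_itv/= !lte_fin -!EFinB.
have [lt1|ge1] := ltP (frac_part C + frac_part a) 1.
  rewrite [Num.max _ _]max_r; last by lra.
  have -> : (2 - frac_part C - frac_part a < 1) = false by apply/negbTE; rewrite -leNgt; lra.
  by rewrite adde0; case: ifP => _; rewrite lee_fin; lra.
rewrite [Num.max _ _]max_l; last by lra.
by case: ifP => _; case: ifP => _; rewrite -?EFinD ?add0e ?adde0 lee_fin; lra.
Qed.

End carries.

(** * Union bound and Chernoff bound *)

Section probability_bounds.
Variables (d : measure_display) (T : measurableType d) (R : realType).
Variable P : probability T R.

Lemma probability_bigsetU_le (I : Type) (s : seq I) (Q : pred I) (E : I -> set T) :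
    (forall i, Q i -> measurable (E i)) ->
  measurable (\big[setU/set0]_(i <- s | Q i) E i) /\
  (P (\big[setU/set0]_(i <- s | Q i) E i) <= \sum_(i <- s | Q i) P (E i))%E.
Proof.
move=> mE; elim: s => [|i s [mU IH]]; first by rewrite !big_nil measure0; split.
rewrite !big_cons; case: ifP => // Qi; split; first by apply: measurableU; [exact: mE|].
by apply: le_trans (measureU2 _ (mE i Qi) mU) _; rewrite leeD2l.
Qed.

Lemma bigsetU_mem (I : finType) (Q : pred I) (E : I -> set T) i w :
  Q i -> E i w -> (\big[setU/set0]_(i | Q i) E i) w.
Proof. by move=> Qi Ew; rewrite (bigD1 i)//=; left. Qed.

(* Chernoff's bound with base [1 + u]; independence enters through the joint law
   of the indicators [r j \in D j], which is a finite sum. *)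
Lemma chernoff_carries (n : nat) (r : 'I_n -> {RV P >-> R}) (D : 'I_n -> set R)
    (p : 'I_n -> R) (m : 'I_n -> nat) (u M : R) (L : nat) :
    mutually_independent r -> (forall j, measurable (D j)) ->
    (forall j, (P (r j @^-1` D j) <= (p j)%:E)%E) -> 0 <= u ->
    \sum_j ((m j)%:R + p j) <= M ->
  let overload := [set w | (L <= \sum_j (m j + (r j w \in D j)))%N] in
  measurable overload /\
  (P overload <= ((1 + u) ^- L * expR (u * M))%:E)%E.
Proof.
move=> indep mD Pp u0 sumM overload.
(* A pattern [b] records which cups carry, and [E b] is the event that exactly this pattern
   occurs. *)
pose A (b : {ffun 'I_n -> bool}) j := if b j then D j else ~` D j.
pose E b := [set w | forall j, j \in [set: 'I_n]%SET -> A b j (r j w)].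
pose Q (b : {ffun 'I_n -> bool}) := (L <= \sum_j (m j + b j))%N.
pose pj j := fine (P (r j @^-1` D j)).
pose g j (b : bool) := if b then pj j else 1 - pj j.
have mrD j (B : set R) : measurable B -> measurable (r j @^-1` B).
  by move=> mB; rewrite -[X in measurable X]setTI; exact: measurable_funPT.
have mA b j : measurable (A b j).
  by rewrite /A; case: ifP => _ //; exact: measurableC.
have EpjE j : P (r j @^-1` D j) = (pj j)%:E.
  by rewrite fineK// fin_num_measure//; exact: mrD.
have mE b : measurable (E b).
  have -> : E b = \bigcap_(j in [set: 'I_n]) (r j @^-1` A b j).
    by apply/seteqP; split => w /= Ew j _; apply: Ew; rewrite ?inE.
  by apply: fin_bigcap_measurable => // j _; exact: mrD.
have PE b : P (E b) = (\prod_j g j (b j))%:E.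
  rewrite indep// -prodEFin; apply: eq_big => [j|j _]; first by rewrite inE.
  rewrite /A /g; case: (b j); first exact: EpjE.
  by rewrite preimage_setC (probability_setC P (mrD j _ (mD j))) EpjE.
have g01 j b : 0 <= g j b.
  rewrite /g; case: b; first by rewrite -lee_fin -EpjE.
  have := probability_le1 P (mrD j _ (mD j)).
  by rewrite EpjE lee_fin subr_ge0.
have EU : overload = \big[setU/set0]_(b | Q b) E b.
  apply/seteqP; split => w /=.
    move=> Lw; apply: (@bigsetU_mem _ Q _ [ffun j => r j w \in D j]).
      by rewrite /Q; under eq_bigr do rewrite ffunE.
    move=> j _; rewrite /A ffunE; case: ifPn; first by rewrite inE.
    by rewrite notin_setE.
  elim/big_ind: _ => //.
    by move=> X Y HX HY [/HX|/HY].
  move=> b Qb Eb; apply: leq_trans Qb _; apply: leq_sum => j _.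
  rewrite leq_add2l; have := Eb j (finset.in_setT j); rewrite /A.
  by case: (b j) => // Dj; rewrite (mem_set Dj).
have [mU PU] := @probability_bigsetU_le _ (index_enum _) Q E (fun b _ => mE b).
rewrite EU; split=> //; apply: le_trans PU _.
rewrite (eq_bigr (fun b : {ffun 'I_n -> bool} => (\prod_j g j (b j))%:E));
  last by move=> b _; exact: PE.
rewrite sumEFin lee_fin.
have u1 : 1 <= 1 + u by rewrite lerDl.
have u10 : 0 < 1 + u by rewrite (lt_le_trans ltr01).
have u_ge0 := ltW u10.
(* Markov's inequality: a pattern in [Q] has weight at least [(1 + u) ^ L], and the patterns outside
   [Q] only add to the sum. *)
apply: (@le_trans _ _ ((1 + u) ^- L *
    \sum_(b : {ffun 'I_n -> bool}) \prod_j (g j (b j) * (1 + u) ^+ (m j + b j)))).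
  rewrite mulr_sumr [leRHS](bigID Q)/= -[leLHS]addr0; apply: lerD; last first.
    apply: sumr_ge0 => b _; rewrite mulr_ge0 ?invr_ge0 ?exprn_ge0//.
    by apply: prodr_ge0 => j _; rewrite mulr_ge0 ?exprn_ge0.
  apply: ler_sum => b Qb; rewrite big_split/= mulrCA ler_peMr//.
    exact: prodr_ge0.
  rewrite -expr_sum mulrC ler_pdivlMr ?exprn_gt0// mul1r.
  exact: ler_weXn2l.
(* By distributivity the sum over patterns is a product of one moment factor per cup. *)
rewrite -(bigA_distr_bigA (fun j (b : bool) => g j b * (1 + u) ^+ (m j + b))).
rewrite ler_wpM2l ?invr_ge0 ?exprn_ge0//.
apply: (@le_trans _ _ (\prod_j expR (u * ((m j)%:R + p j)))); last first.
  by rewrite -expR_sum ler_expR -mulr_sumr ler_wpM2l.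
apply: ler_prod => j _; apply/andP; split.
  by apply: sumr_ge0 => b _; rewrite mulr_ge0 ?exprn_ge0.
rewrite big_bool/= addn1 addn0 /g exprS.
have -> : pj j * ((1 + u) * (1 + u) ^+ m j) + (1 - pj j) * (1 + u) ^+ m j =
    (1 + u) ^+ m j * (1 + u * pj j) by ring.
rewrite [u * (_ + p j)]mulrDr expRD; apply: ler_pM.
- by rewrite exprn_ge0.
- by rewrite addr_ge0// mulr_ge0// (g01 j true).
- by rewrite mulrC expRM_natl lerXn2r ?nnegrE ?expR_ge0 ?expR_ge1Dx.
- apply: le_trans (expR_ge1Dx _) _; rewrite ler_expR ler_wpM2l//.
  by rewrite -lee_fin -EpjE.
Qed.

End probability_bounds.

(** * The last calm step *)

Section last_calm_step.
Variables (R : realType) (n : nat) (c : nat -> 'I_n -> R) (x : nat -> 'I_n -> R).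
Variables (s r : 'I_n -> R) (b eps : R) (i : nat).
Hypothesis c_ge0 : forall t j, 0 <= c t.+1 j.
Hypothesis c_le : forall t, \sum_j c t.+1 j <= 1 - eps.
Hypothesis greedy : forall t, greedy_removal (fun j => x t j + c t.+1 j) (x t.+1).
Hypothesis s_ge0 : forall j, 0 <= s j.
Hypothesis sum_s : \sum_j s j = b.
Hypothesis r01 : forall j, 0 < r j <= 1.
Hypothesis x0 : forall j, x 0 j = s j + r j.
Hypothesis b_lt : b < eps * i%:R.

Lemma calm_step_exists : exists2 t, (t <= i)%N & forall j, x t j < 2.
Proof.
apply: contrapT => nocalm.
have busy m : (0 < m <= 0 + i)%N -> exists j, 2 <= x m j.
  move=> /andP[_ mi]; apply: contrapT => nobig; apply: nocalm.
  by exists m => // j; rewrite ltNge; apply/negP => xj; apply: nobig; exists j.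
have [rem [sum_rem x_rem rem_ge1]] := busy_removals c_ge0 greedy busy.
(* A cup that loses a unit ends with at least 1, which covers [r j]; so the removals are paid for by
   initial and poured water alone. *)
have rem_le j : (rem j)%:R <= s j + poured c 0 i j.
  have p0 : 0 <= poured c 0 i j by exact: poured_ge0.
  have [->|rem0] := posnP (rem j); first by rewrite addr_ge0.
  have := rem_ge1 j rem0; rewrite x_rem x0.
  by have /andP[_ r1] := r01 j; lra.
have : i%:R <= b + i%:R * (1 - eps).
  rewrite -{1}sum_rem natr_sum -sum_s.
  apply: le_trans (ler_sum _ (fun j _ => rem_le j)) _.
  rewrite big_split/= lerD2l exchange_big/=.
  rewrite mulr_natl -[X in _ *+ X]card_ord -sumr_const.
  by apply: ler_sum.
by move: b_lt; lra.
Qed.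

(** Here [i - l] is the last calm step. It depends on [r], but for each fixed [l] the water poured
    before and after it does not, so the second alternative concerns fixed carry sets. *)
Lemma fill_le_or_overload p : exists2 l, (l <= i)%N &
  if (l <= 2 ^ p)%N then forall j, x i j <= 3 + p%:R
  else (l <= \sum_j (Num.truncn (poured c (i - l) l j) +
      (r j \in carry_set (s j + poured c 0 (i - l) j) (poured c (i - l) l j))))%N.
Proof.
have c_le1 t : \sum_j c t.+1 j <= 1.
  have : 0 <= eps * i%:R.
    by apply: le_trans (ltW b_lt); rewrite -sum_s; exact: sumr_ge0.
  have i0 : (0 < i)%N.
    rewrite lt0n; apply/eqP => i0; move: b_lt; rewrite i0 mulr0 -sum_s.
    by rewrite ltNge sumr_ge0.
  rewrite pmulr_lge0 ?ltr0n// => eps0.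
  by have := c_le t; lra.
pose calm t := [forall j, x t j < 2] && (t <= i)%N.
have exc : exists t, calm t.
  by have [t ti ct] := calm_step_exists; exists t; rewrite /calm ti andbT; apply/forallP.
have calm_le t : calm t -> (t <= i)%N by case/andP.
case: (ex_maxnP exc calm_le) => t /andP[/forallP ct ti] t_max.
exists (i - t)%N; first exact: leq_subr.
rewrite subKn//.
case: ifP => lp.
  by move=> j; have := greedy_fill_le c_ge0 greedy c_le1 j ct lp; rewrite subnKC.
have busy m : (t < m <= t + (i - t))%N -> exists j, 2 <= x m j.
  rewrite subnKC// => /andP[tm mi]; apply: contrapT => nobig.
  have : calm m.
    rewrite /calm mi andbT; apply/forallP => j; rewrite ltNge.
    by apply/negP => xj; apply: nobig; exists j.
  by move/t_max; rewrite leqNgt tm.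
have [rem [sum_rem x_rem rem_ge1]] := busy_removals c_ge0 greedy busy.
rewrite -[leqLHS]sum_rem; apply: leq_sum => j _.
have [->//|rem0] := posnP (rem j).
have [q xq] := removed_count greedy t j.
have a0 : 0 <= s j + poured c 0 t j by rewrite addr_ge0// poured_ge0.
have E : x t j = r j + (s j + poured c 0 t j) - q%:R by rewrite xq x0; lra.
apply: (removals_le_carry (q := q)) => //; first exact: poured_ge0.
  by rewrite -E.
by rewrite -E -x_rem; exact: rem_ge1.
Qed.

End last_calm_step.

(** * Numerical estimates *)

Section numerics.
Variable R : realType.

(** The choice [u = eps / 2] minimises the exponent [u ^ 2 - eps * u] per step, with value
    [- eps ^ 2 / 4]. *)
Lemma chernoff_rate (eps : R) (L : nat) : 0 < eps -> eps <= 1 / 2 ->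
  (1 + eps / 2) ^- L * expR (eps / 2 * (L%:R * (1 - eps)))
    <= expR (- (eps ^+ 2 / 4)) ^+ L.
Proof.
move=> e0 e1; set u := eps / 2.
have u0 : 0 < 1 + u by rewrite /u; lra.
have base : (1 + u)^-1 <= expR (- u + u ^+ 2).
  apply: le_trans (expR_ge1Dx _).
  rewrite -div1r ler_pdivrMr//.
  have -> : (1 + (- u + u ^+ 2)) * (1 + u) = 1 + u ^+ 3 by ring.
  by rewrite lerDl exprn_ge0// /u; lra.
have -> : u * (L%:R * (1 - eps)) = L%:R * (u * (1 - eps)) by ring.
rewrite expRM_natl -exprVn -exprMn.
apply: lerXn2r; rewrite ?nnegrE ?expR_ge0//.
  by rewrite mulr_ge0 ?expR_ge0// invr_ge0 ltW.
apply: le_trans (ler_wpM2r (expR_ge0 _) base) _.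
rewrite -expRD ler_expR.
have -> : - u + u ^+ 2 + u * (1 - eps) = - (eps ^+ 2 / 4) by rewrite /u; field.
by [].
Qed.

Lemma geometric_tail (q : R) (W i : nat) : 0 <= q <= 1 ->
  (1 - q) * \sum_(t < i | (W <= t)%N) q ^+ t.+1 <= q ^+ W.
Proof.
move=> /andP[q0 q1].
(* The subtracted power makes the bound inductive: adding the term of index [i] leaves slack
   [q ^ i * (1 - q) ^ 2]. *)
suff : (1 - q) * \sum_(t < i | (W <= t)%N) q ^+ t.+1 <= q ^+ W - q ^+ (maxn i W).
  by move/le_trans; apply; rewrite gerBl exprn_ge0.
elim: i => [|i IH]; first by rewrite big_ord0 max0n mulr0 subrr.
rewrite big_mkcond big_ord_recr/= -big_mkcond/= mulrDr.
case: ifPn => [Wi|iW].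
  have -> : maxn i.+1 W = i.+1 by lia.
  have Ei : maxn i W = i by lia.
  rewrite Ei in IH; apply: le_trans (lerD IH (lexx _)) _.
  have : 0 <= q ^+ i * (1 - q) ^+ 2 by rewrite mulr_ge0 ?exprn_ge0 ?subr_ge0.
  by rewrite expr2 exprS; lra.
rewrite mulr0 addr0.
have -> : maxn i.+1 W = W by lia.
have Ei : maxn i W = W by lia.
by rewrite Ei in IH.
Qed.

Lemma geometric_expR_tail (y : R) (W i : nat) : 0 < y -> y <= 1 ->
  \sum_(t < i | (W <= t)%N) expR (- y) ^+ t.+1 <= 2 / y * expR (- y) ^+ W.
Proof.
move=> y0 y1; have q0 := expR_ge0 (- y).
have q1 : expR (- y) <= 1 by rewrite -expR0 ler_expR; lra.
(* Indeed [1 - exp (- y) >= y / (1 + y) >= y / 2] for [y <= 1]. *)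
have gap : y / 2 <= 1 - expR (- y).
  have : expR (- y) * (1 + y) <= 1.
    rewrite -[leRHS](expR0 R) -(addNr y) expRD ler_wpM2l// expR_ge1Dx//.
  have : 0 <= y * (1 - expR (- y)) by rewrite mulr_ge0 ?subr_ge0// ltW.
  nra.
have sum_ge0 : 0 <= \sum_(t < i | (W <= t)%N) expR (- y) ^+ t.+1.
  by apply: sumr_ge0 => t _; rewrite exprn_ge0.
have q01 : 0 <= expR (- y) <= 1 by rewrite q0.
have le_qW := geometric_tail W i q01.
rewrite -(ler_pM2l (_ : 0 < y / 2)) ?divr_gt0// mulrA.
have -> : y / 2 * (2 / y) = 1 by field; rewrite gt_eqF.
by rewrite mul1r; apply: le_trans (ler_wpM2r sum_ge0 gap) le_qW.
Qed.

(** With [z] the power of 2 with exponent [k / 6], the hypotheses give [1 / eps <= z ^ 2] and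
    [z ^ 6 <= 32 * 2 ^ p]. The prefactor is thus at most [8 * z ^ 4], and the decay exponent at
    least [z ^ 2 / 128 = 2 * v]. *)
Lemma tail_numerics (eps k : R) (p : nat) :
    0 < eps -> eps <= 1 / 2 -> 3 * log2 (1 / eps) <= k -> k < p%:R + 5 ->
  2 / (eps ^+ 2 / 4) * expR (- (eps ^+ 2 / 4)) ^+ (2 ^ p)
    <= 2 ^+ 20 * expR 64 * expR (- (2 `^ (6^-1 * k))).
Proof.
move=> e0 e1 epsk kp; set z := 2 `^ (6^-1 * k).
have z0 : 0 < z by exact: powR_gt0.
have zX m : z ^+ m = 2 `^ (6^-1 * k * m%:R) by rewrite [RHS]powRrM powR_mulrn ?powR_ge0.
have eps_inv : eps^-1 <= z ^+ 2.
  have ln2 : 0 < ln 2 :> R by rewrite ln_gt0// ltr1n.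
  rewrite zX -[leLHS]lnK ?posrE ?invr_gt0// /powR pnatr_eq0/= ler_expR.
  move: epsk; rewrite /log2 div1r mulrA ler_pdivrMr//.
  by set a := ln _; set b := ln _; lra.
have epsz : 1 <= eps ^+ 2 * z ^+ 4.
  have h : 1 <= eps * z ^+ 2.
    by rewrite -(ler_pM2l (_ : 0 < eps^-1)) ?invr_gt0// mulr1 mulKf ?gt_eqF.
  have -> : eps ^+ 2 * z ^+ 4 = (eps * z ^+ 2) ^+ 2 by ring.
  by rewrite exprn_ege1.
have Wz : z ^+ 6 <= 32 * (2 ^ p)%:R.
  rewrite zX natrX -(powR_mulrn p)//.
  have -> : 32 = 2 `^ 5 :> R by rewrite (powR_mulrn 5)//; ring.
  by rewrite -powRD ?pnatr_eq0 ?implybT//; apply: ler_powR; rewrite ?ler1n//; lra.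
have exponent : z ^+ 2 / 128 <= eps ^+ 2 / 4 * (2 ^ p)%:R.
  have h1 : z ^+ 2 <= eps ^+ 2 * z ^+ 6.
    have -> : eps ^+ 2 * z ^+ 6 = z ^+ 2 * (eps ^+ 2 * z ^+ 4) by ring.
    by rewrite ler_peMr// exprn_ge0// ltW.
  have h2 : eps ^+ 2 * z ^+ 6 <= eps ^+ 2 * (32 * (2 ^ p)%:R).
    by rewrite ler_wpM2l// exprn_ge0// ltW.
  by move: h1 h2; set A := eps ^+ 2; set B := z ^+ 6; set W := (2 ^ p)%:R; lra.
have factor : 2 / (eps ^+ 2 / 4) <= 8 * z ^+ 4.
  rewrite ler_pdivrMr ?divr_gt0 ?exprn_gt0//.
  by move: epsz; set A := eps ^+ 2; set B := z ^+ 4; lra.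
set v := z ^+ 2 / 256.
have v0 : 0 <= v by rewrite divr_ge0 ?exprn_ge0 ?ltW.
have expv : v ^+ 2 <= 2 * expR v.
  have := @expR_ge1Dxn R v 1 v0; rewrite (_ : 2`! = 2)%N; last by [].
  by set a := v ^+ 2; set b := expR v; lra.
rewrite -expRM_natl.
(* One factor [exp (- v)] absorbs [z ^ 4] through [v ^ 2 <= 2 * exp v]; the other remains as the
   decay. *)
apply: (@le_trans _ _ (8 * z ^+ 4 * expR (- v - v))).
  apply: ler_pM => //; first by rewrite !divr_ge0 ?exprn_ge0 ?ltW.
  by rewrite ler_expR /v; lra.
have -> : 8 * z ^+ 4 = 2 ^+ 19 * v ^+ 2 by rewrite /v; field.
apply: (@le_trans _ _ (2 ^+ 19 * (2 * expR v) * expR (- v - v))).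
  by rewrite ler_wpM2r// ler_wpM2l// exprn_ge0.
have -> : 2 ^+ 19 * (2 * expR v) * expR (- v - v) = 2 ^+ 20 * (expR v * expR (- v - v)).
  by ring.
rewrite -mulrA -!expRD ler_wpM2l ?exprn_ge0// ler_expR.
(* This gives [v >= z - 64], the source of the constant [expR 64]. *)
have : 0 <= (z - 128) ^+ 2 by exact: sqr_ge0.
by rewrite /v !expr2; lra.
Qed.

Lemma expRN_le_powR2 (y : R) : 0 <= y -> expR (- y) <= 2 `^ (- y).
Proof.
move=> y0; rewrite /powR pnatr_eq0/= ler_expR mulNr lerN2 ler_piMr//.
by have := @le_ln1Dx R 1; rewrite -natr1; apply; lra.
Qed.

End numerics.

(** * Measurability of the backlog event and probability of an overload *)

Lemma measurable_backlog_ge (d : measure_display) (T : measurableType d)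
    (R : realType) (P : probability T R) (n : nat) (X : 'I_n -> {RV P >-> R}) (k : R) :
  0 < k -> measurable [set w | k <= backlog (fun j => X j w)].
Proof.
move=> k0.
have -> : [set w | k <= backlog (fun j => X j w)] =
    \bigcup_(j in [set: 'I_n]) (X j @^-1` `[k, +oo[).
  apply/seteqP; split => w /=.
    (* Since [k > 0], the default value 0 of the maximum cannot cause the event. *)
    move=> /bigmax_geP[|[j _ kj]]; first by rewrite leNgt k0.
    by exists j => //=; rewrite in_itv/= kj.
  move=> [j _ /=]; rewrite in_itv/= andbT => kj.
  by apply/bigmax_geP; right; exists j.
apply: fin_bigcup_measurable => // j _.
by rewrite -[X in measurable X]setTI; exact: measurable_funPT.
Qed.

(** A uniform [r j] lies in its carry set with probability at most [frac_part (C j)], so the mean in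
    Chernoff's bound is at most the total poured, hence at most [L * (1 - eps)]. *)
Lemma overload_probability (d : measure_display) (T : measurableType d) (R : realType)
    (P : probability T R) (n : nat) (r : 'I_n -> {RV P >-> R}) (a C : 'I_n -> R)
    (eps : R) (L : nat) :
    mutually_independent r -> (forall j, uniform_oc01 (r j)) ->
    0 < eps -> eps <= 1 / 2 -> (forall j, 0 <= a j) -> (forall j, 0 <= C j) ->
    \sum_j C j <= L%:R * (1 - eps) ->
  let overload := [set w |
    (L <= \sum_j (Num.truncn (C j) + (r j w \in carry_set (a j) (C j))))%N] in
  measurable overload /\ (P overload <= (expR (- (eps ^+ 2 / 4)) ^+ L)%:E)%E.
Proof.
move=> indep unif e0 e1 a0 C0 sumC overload.
have [|j|||mO PO] := @chernoff_carries _ _ _ P n r (fun j => carry_set (a j) (C j))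
  (fun j => frac_part (C j)) (fun j => Num.truncn (C j)) (eps / 2) (L%:R * (1 - eps)) L indep.
- by move=> j; exact: measurable_carry_set.
- have [_ /(_ _ (measurable_carry_set (a j) (C j)))] := unif j.
  by rewrite /distribution /pushforward /= => ->; exact: carry_set_prob.
- by lra.
- by apply: le_trans sumC; apply: ler_sum => j _; rewrite /frac_part addrC subrK.
by split=> //; apply: le_trans PO _; rewrite lee_fin; exact: chernoff_rate.
Qed.

(** * The tail bound on the backlog *)

Theorem theorem9p1 (R : realType) :
  exists C c0 : R, 0 < C /\ 0 < c0 /\
  forall (n : nat) (b eps : R),
    (1 <= n)%N -> 0 <= b -> 0 < eps -> eps <= 1 / 2 ->
  forall (c : nat -> 'I_n -> R), oblivious_filler eps c ->
  forall (s : 'I_n -> R), initial_state b s ->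
  forall (d : measure_display) (T : measurableType d) (P : probability T R)
    (r : 'I_n -> {RV P >-> R}) (F : nat -> 'I_n -> {RV P >-> R}),
    smoothed_greedy s c r F ->
  forall (i : nat) (k : R),
    b / eps < i%:R -> 0 <= k -> 3 * log2 (1 / eps) <= k ->
    (P [set w | (k <= backlog (fun j => F i j w))%R]
       <= (C * 2 `^ (- (2 `^ (c0 * k))))%:E)%E.
Proof.
exists (2 ^+ 20 * expR 64), 6^-1; split; first by rewrite mulr_gt0 ?expR_gt0 ?exprn_gt0.
split; first by rewrite invr_gt0.
move=> n b eps _ b0 e0 e1 c filler s [s_ge0 sum_s] d T P r F.
move=> [indep unif F0 greedy] i k bi k0 epsk.
apply: le_trans (_ : _ <= (2 ^+ 20 * expR 64 * expR (- (2 `^ (6^-1 * k))))%:E)%E _;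
  last first.
  by rewrite lee_fin ler_wpM2l ?mulr_ge0 ?expR_ge0 ?exprn_ge0// expRN_le_powR2// powR_ge0.
(* For [k < 4] the bound is at least 1, as the inner power is at most 2 and [expR 64] dominates. The
   value [k = 0] is separate because measurability was shown for [k > 0]. *)
have [k4|k4] := ltP k 4.
  apply: le_trans (_ : _ <= 1)%E _.
    have [->|kpos] := eqVneq k 0; last first.
      by apply: probability_le1; apply: measurable_backlog_ge; rewrite lt0r kpos.
    have -> : [set w | 0 <= backlog (fun j => F i j w)] = setT.
      apply/seteqP; split => w //= _; rewrite /backlog.
      by apply/bigmax_geP; left.
    by rewrite probability_setT.
  rewrite lee_fin -mulrA -expRD.
  have z2 : 2 `^ (6^-1 * k) <= 2 :> R.
    by rewrite -[leRHS]powRr1//; apply: ler_powR; [rewrite ler1n|lra].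
  by apply: mulr_ege1; [apply: exprn_ege1; rewrite ler1n|rewrite -[leLHS](expR0 R) ler_expR; lra].
(* This choice puts the bound [3 + p] for short busy periods below [k] and keeps [2 ^ p] within a
   factor 32 of [2 ^ k]. *)
pose p := (Num.truncn k - 4)%N.
have [pk kp] : 3 + p%:R < k /\ k < p%:R + 5.
  have /andP[tk kt] := truncn_itv k0.
  have t4 : (4 <= Num.truncn k)%N by rewrite truncn_ge_nat.
  by rewrite /p natrB//; split; [lra|rewrite -natr1 in kt; lra].
have c_ge0 t j : 0 <= c t.+1 j by have [] := filler t.+1 isT.
have c_le t : \sum_j c t.+1 j <= 1 - eps by have [] := filler t.+1 isT.
have r01 j w : 0 < r j w <= 1 by have [/(_ w)] := unif j.
have bei : b < eps * i%:R by rewrite mulrC -ltr_pdivrMr.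
(* The index [t] stands for the length [l = t + 1], so that [l > 2 ^ p] becomes [2 ^ p <= t]. *)
pose a (t : 'I_i) j := s j + poured c 0 (i - t.+1) j.
pose Cw (t : 'I_i) j := poured c (i - t.+1) t.+1 j.
pose E (t : 'I_i) := [set w |
  (t.+1 <= \sum_j (Num.truncn (Cw t j) + (r j w \in carry_set (a t j) (Cw t j))))%N].
have [mE PE] : (forall t, measurable (E t)) /\
    (forall t, (P (E t) <= (expR (- (eps ^+ 2 / 4)) ^+ t.+1)%:E)%E).
  apply: all_and2 => t; apply: overload_probability => //.
  - by move=> j; rewrite addr_ge0// poured_ge0.
  - by move=> j; exact: poured_ge0.
  rewrite exchange_big/= mulr_natl -[X in _ *+ X]card_ord -sumr_const.
  by apply: ler_sum => m _; exact: c_le.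
have [mU PU] := probability_bigsetU_le P (index_enum _)
  (fun t (_ : (2 ^ p <= (t : 'I_i))%N) => mE t).
apply: le_trans (_ : _ <= P (\big[setU/set0]_(t < i | (2 ^ p <= t)%N) E t))%E _.
  apply: le_measure; rewrite ?inE//.
    by apply: measurable_backlog_ge; lra.
  move=> w /= kw.
  have F0w j : F 0 j w = s j + r j w := F0 j w.
  have [l li] := fill_le_or_overload c_ge0 c_le (fun t => greedy t w) s_ge0 sum_s
    (fun j => r01 j w) F0w bei p.
  case: ifPn => lp.
    move=> F_le; suff : backlog (fun j => F i j w) <= 3 + p%:R by lra.
    by apply: bigmax_le => [|j _]; [rewrite addr_ge0|exact: F_le].
  rewrite -ltnNge in lp; case: l li lp => // l li lp over.
  exact: (@bigsetU_mem _ _ _ (fun t : 'I_i => (2 ^ p <= t)%N) E (Ordinal li)).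
apply: le_trans PU _.
apply: le_trans (_ : _ <= \sum_(t < i | (2 ^ p <= t)%N)
    (expR (- (eps ^+ 2 / 4)) ^+ t.+1)%:E)%E _.
  by apply: lee_sum => t _; exact: PE.
rewrite sumEFin lee_fin.
apply: le_trans (geometric_expR_tail _ _ _ _) _; last exact: tail_numerics.
  by rewrite divr_gt0 ?exprn_gt0.
have : eps ^+ 2 <= 1 by rewrite exprn_ile1 ?ltW//; lra.
lra.
Qed.
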